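(* Let $\mathfrak{g}$ be a real nilpotent Lie algebra of dimension $2n$ with nilindex $m=\mathrm{nil}(\mathfrak{g})$, and suppose $\mathfrak{g}$ carries a (left-invariant) generalized complex structure of type $k>1$. Suppose there is an integer $j>0$ such that $\dim(V_{i+1}/V_i)=1$ for all $i$ with $j\le i\le m-1$. Then $$k\le \begin{cases} 2n-\mathrm{nil}(\mathfrak{g})+j-2 & \text{if } j>1,\\ 2n-\mathrm{nil}(\mathfrak{g}) & \text{if } j=1.\end{cases}$$
   Context: Lower central series: $\mathfrak{g}^0=\mathfrak{g}$, $\mathfrak{g}^i=[\mathfrak{g}^{i-1},\mathfrak{g}]$; the nilindex $m=\mathrm{nil}(\mathfrak{g})$ is the least $m$ with $\mathfrak{g}^m=0$. For $i\ge 0$, $V_i\subset\mathfrak{g}^*$ is the annihilator of $\mathfrak{g}^i$, so $V_0=0$ and $V_m=\mathfrak{g}^*$. The differential $d$ on $\Lambda\mathfrak{g}^*$ is the Chevalley–Eilenberg differential, e.g. $d\alpha(X,Y)=-\alpha([X,Y])$ for $\alpha\in\mathfrak{g}^*$. On $\mathfrak{g}\oplus\mathfrak{g}^*$ the Courant bracket is $[X+\xi,Y+\eta]_c=[X,Y]+I_X d\eta-I_Y d\xi$ (here $I$ is interior product; this is the Courant bracket for left-invariant objects), and the inner product is $\langle X+\xi,Y+\eta\rangle=\tfrac12(\xi(Y)+\eta(X))$. A generalized complex structure on $\mathfrak{g}$ is a linear map $\mathcal{J}$ of $\mathfrak{g}\oplus\mathfrak{g}^*$ with $\mathcal{J}^2=-\mathrm{Id}$,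 orthogonal for $\langle\,,\rangle$, whose $+i$-eigenspace $L\subset(\mathfrak{g}\oplus\mathfrak{g}^* )\otimes\mathbb{C}$ is closed under the (complexified) Courant bracket. Its type $k$ is the complex codimension in $\mathfrak{g}\otimes\mathbb{C}$ of the projection of $L$ onto $\mathfrak{g}\otimes\mathbb{C}$. *)

(* Defs.v *)
From HB Require Import structures.
From mathcomp Require Import all_boot all_order all_algebra.
From mathcomp Require Import complex.
From mathcomp Require Import reals.
Set Implicit Arguments. Unset Strict Implicit. Unset Printing Implicit Defensive.
Import Order.TTheory GRing.Theory Num.Theory.
Local Open Scope ring_scope.

(* A real Lie algebra g of dimension N is modelled as R^N (row vectors)
   with the bilinear bracket given by structure constants
   c i j = [e_i, e_j].  gdual is also modelled by row vectors (coordinates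
   in the dual basis), with  ev xi X = xi(X) = sum_i xi_i X_i.
   Everything is written over an arbitrary ring F so that the same
   formulas give the complexified objects (F = complex R, constants
   mapped through the real embedding). *)

Section Generic.
Variables (F : comUnitRingType) (N : nat).
Variable c : 'I_N -> 'I_N -> 'rV[F]_N.

Definition br (x y : 'rV[F]_N) : 'rV[F]_N :=
  \sum_(i < N) \sum_(j < N) (x 0 i * y 0 j) *: c i j.

Definition ev (xi x : 'rV[F]_N) : F := \sum_(i < N) xi 0 i * x 0 i.

Definition ebase (k : 'I_N) : 'rV[F]_N := delta_mx 0 k.

(* I_X d(eta): the covector Z |-> d eta (X, Z) = - eta([X, Z]) *)
Definition ixd (x eta : 'rV[F]_N) : 'rV[F]_N :=
  \row_(k < N) (- ev eta (br x (ebase k))).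

Definition courant (A B : 'rV[F]_(N + N)) : 'rV[F]_(N + N) :=
  row_mx (br (lsubmx A) (lsubmx B))
         (ixd (lsubmx A) (rsubmx B) - ixd (lsubmx B) (rsubmx A)).

Definition pairing (A B : 'rV[F]_(N + N)) : F :=
  2^-1 * (ev (rsubmx A) (lsubmx B) + ev (rsubmx B) (lsubmx A)).
End Generic.

Section Real.
Variables (R : realType) (N : nat).
Variable c : 'I_N -> 'I_N -> 'rV[R]_N.

Definition is_lie_algebra : Prop :=
  (forall x, br c x x = 0) /\
  (forall x y z, br c x (br c y z) + br c y (br c z x) + br c z (br c x y) = 0).

Fixpoint lcs (i : nat) : 'M[R]_N :=
  match i with
  | 0 => 1%:M
  | i'.+1 => (\sum_(r < N) \sum_(k < N) <<br c (row r (lcs i')) (ebase R k)>>)%MS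
  end.

Definition Vann (i : nat) : 'M[R]_N := kermx (lcs i)^T.

Definition dimVquot (i : nat) : nat := \rank (Vann i.+1 :\: Vann i)%MS.

Definition is_nilindex (m : nat) : Prop :=
  lcs m = 0 /\ forall i, (i < m)%N -> lcs i != 0.

Definition cC : 'I_N -> 'I_N -> 'rV[R[i]]_N :=
  fun i j => map_mx (real_complex R) (c i j).

(* a linear map J of g (+) gdual (row-vector convention: A |-> A *m J) *)
Definition JC (J : 'M[R]_(N + N)) : 'M[R[i]]_(N + N) :=
  map_mx (real_complex R) J.

Definition Lspace (J : 'M[R]_(N + N)) : 'M[R[i]]_(N + N) :=
  kermx (JC J - (Complex 0 1 : R[i])%:M).

Definition is_gen_complex (J : 'M[R]_(N + N)) : Prop :=
  [/\ J *m J = - 1%:M,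
      (forall A B : 'rV[R]_(N + N), pairing (A *m J) (B *m J) = pairing A B)
    & (forall A B : 'rV[R[i]]_(N + N),
          (A <= Lspace J)%MS -> (B <= Lspace J)%MS ->
          (courant (cC) A B <= Lspace J)%MS)].

Definition gc_type (J : 'M[R]_(N + N)) : nat :=
  (N - \rank (lsubmx (Lspace J)))%N.
End Real.

(* Main.v *)
(* Let E be the projection of L to g_C and K its annihilator in g*_C.  Then E is
   a subalgebra, K = L cap g*_C has dimension k, and K contains no conjugate
   pair of nonzero covectors, so that 2 dim (K cap V_i) <= dim V_i.  For a
   covector th, th is in V_(i+1) iff d th vanishes on g^i x g; and d th vanishes
   on E x E when th is in K.
   If V_(i+1)/V_i is a line and K cap V_(i+1) is larger than K cap V_i, then
   K cap V_i is larger than K cap V_(i-1): otherwise E cap g^(i-1) surjects onto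
   g^(i-1)/g^i, and for a real generator alpha of V_(i+1)/V_i the covectors
   alpha [x, .] with x real in g^(i-1) all lie in K, hence vanish, so that alpha
   is in V_i.  Therefore, from j on, dim (K cap V_i) grows together with dim V_i
   up to some index and is constant afterwards.  At that index
   2 dim (K cap V_i) <= dim V_i gives k <= dim V_j - dim (K cap V_j), and if any
   growth occurs then dim (K cap V_j) >= 2 for j > 1, and >= 1 for j = 1. *)
Require Import Defs.
From HB Require Import structures.
From mathcomp Require Import all_boot all_order all_algebra.
From mathcomp Require Import complex reals.
From mathcomp Require Import zify ring.
Import Order.TTheory GRing.Theory Num.Theory.
Local Open Scope ring_scope.

(** * The Lie bracket and the 2-forms attached to covectors *)

Section Bracket.
Set Implicit Arguments. Unset Strict Implicit.
Variables (F : comUnitRingType) (N : nat) (c : 'I_N -> 'I_N -> 'rV[F]_N).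

(* The Gram matrix of the 2-form (x, y) |-> xi [x, y], that is, of - d xi. *)
Definition dmx (xi : 'rV[F]_N) : 'M[F]_N := \matrix_(i, j) ev xi (c i j).

Lemma evE (xi x : 'rV[F]_N) : ev xi x = (xi *m x^T) 0 0.
Proof. by rewrite mxE; apply: eq_bigr => i _; rewrite mxE. Qed.

Lemma br_dmx (xi x y : 'rV[F]_N) : ev xi (br c x y) = (x *m dmx xi *m y^T) 0 0.
Proof.
rewrite /br /ev mxE.
under eq_bigr => l _ do rewrite summxE mulr_sumr.
under [RHS]eq_bigr => j _ do rewrite !mxE mulr_suml.
rewrite exchange_big [RHS]exchange_big /=; apply: eq_bigr => i _.
under eq_bigr => l _ do rewrite summxE mulr_sumr.
rewrite exchange_big /=; apply: eq_bigr => j _.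
rewrite mxE mulrAC /ev mulr_sumr; apply: eq_bigr => l _.
by rewrite !mxE; ring.
Qed.

Lemma dmxP (a : F) (xi eta : 'rV[F]_N) : dmx (a *: xi + eta) = a *: dmx xi + dmx eta.
Proof.
apply/matrixP => i j; rewrite !mxE /ev mulr_sumr -big_split /=.
by apply: eq_bigr => l _; rewrite !mxE; ring.
Qed.

Lemma br_sumE (x y : 'rV[F]_N) :
  br c x y = x *m (\matrix_i \sum_j y 0 j *: c i j).
Proof.
rewrite mulmx_sum_row; apply: eq_bigr => i _.
by rewrite rowK scaler_sumr; apply: eq_bigr => j _; rewrite scalerA.
Qed.

Lemma br_ebase (i j : 'I_N) : br c (ebase F i) (ebase F j) = c i j.
Proof.
rewrite br_sumE -rowE rowK (bigD1 j) //= mxE !eqxx scale1r big1 ?addr0 //.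
by move=> l /negPf jl; rewrite mxE jl andbF scale0r.
Qed.

Lemma brDl (x y z : 'rV[F]_N) : br c (x + y) z = br c x z + br c y z.
Proof. by rewrite !br_sumE mulmxDl. Qed.

Lemma brDr (x y z : 'rV[F]_N) : br c x (y + z) = br c x y + br c x z.
Proof.
rewrite !br_sumE -mulmxDr; congr (_ *m _); apply/row_matrixP => i.
rewrite linearD /= !rowK -big_split /=; apply: eq_bigr => j _.
by rewrite !mxE scalerDl.
Qed.

Lemma structure_skew : (forall x, br c x x = 0) -> forall i j, c i j = - c j i.
Proof.
move=> alt i j; apply/eqP; rewrite -addr_eq0 -!br_ebase; apply/eqP.
have := alt (ebase F i + ebase F j).
by rewrite brDl !brDr !alt add0r addr0.
Qed.

Lemma dmx_skew (xi : 'rV[F]_N) :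
  (forall i j, c i j = - c j i) -> (dmx xi)^T = - dmx xi.
Proof.
move=> skew; apply/matrixP => i j; rewrite !mxE skew.
by rewrite /ev -sumrN; apply: eq_bigr => l _; rewrite mxE mulrN.
Qed.

End Bracket.

(** * Complexification, annihilators of the lower central series, duality *)

Section Main.
Set Implicit Arguments. Unset Strict Implicit.
Variables (R : realType) (N : nat) (c : 'I_N -> 'I_N -> 'rV[R]_N).
Local Notation C := R[i].
Local Notation rc A := (map_mx (real_complex R) A).
Local Notation I := (Complex 0 1 : C).

Lemma mulii : I * I = -1.
Proof. by rewrite -expr2 sqr_i. Qed.

Lemma rc_ReIm m p (A : 'M[C]_(m, p)) :
  A = rc (map_mx (@complex.Re R) A) + I *: rc (map_mx (@complex.Im R) A).
Proof. by apply/matrixP => i j; rewrite !mxE [LHS]complexE. Qed.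

Lemma rc_ReIm_eq0 m p (A B : 'M[R]_(m, p)) :
  (rc A + I *: rc B == 0) = (A == 0) && (B == 0).
Proof.
apply/eqP/andP => [/matrixP AB | [/eqP-> /eqP->]]; last first.
  by rewrite !map_mx0 scaler0 addr0.
split; apply/eqP/matrixP => i j; have := AB i j; rewrite !mxE /= => /eqP;
  rewrite eq_complex /= !(mulr0, mul0r, mul1r, addr0, add0r, subr0, oppr0).
- by case/andP => /eqP ->.
- by case/andP => _ /eqP ->.
Qed.

(** The cokernel of [V] is real, so the membership equation separates into real and imaginary
    parts. *)
Lemma rc_ReIm_sub m n p (A B : 'M[R]_(m, p)) (V : 'M[R]_(n, p)) :
  ((rc A + I *: rc B)%R <= rc V)%MS = (A <= V)%MS && (B <= V)%MS.
Proof.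
rewrite !submxE -map_cokermx mulmxDl -scalemxAl -!map_mxM.
exact: rc_ReIm_eq0.
Qed.

Lemma lcs_subP n (A : 'M[R]_(n, N)) i :
  reflect (forall r k, (br c (row r (lcs c i)) (ebase R k) <= A)%MS) (lcs c i.+1 <= A)%MS.
Proof.
apply: (iffP sumsmx_subP) => [H r k | H r _].
  by have /sumsmx_subP/(_ k isT) := H r isT; rewrite genmxE.
by apply/sumsmx_subP => k _; rewrite genmxE.
Qed.

Lemma lcsS_sub i : (lcs c i.+1 <= lcs c i)%MS.
Proof.
elim: i => [|i IH]; first exact: submx1.
apply/lcs_subP => r k; have [u ->] := submxP (submx_trans (row_sub r _) IH).
rewrite br_sumE -mulmxA; apply: submx_trans (submxMl _ _) _.
apply/row_subP => s; rewrite row_mul -br_sumE.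
by move/lcs_subP: (submx_refl (lcs c i.+1)); apply.
Qed.

Lemma Vann_subE m i (U : 'M[R]_(m, N)) :
  (U <= Vann c i)%MS = (U *m (lcs c i)^T == 0).
Proof. by apply/sub_kermxP/eqP. Qed.

Lemma rc_Vann_subE m i (U : 'M[C]_(m, N)) :
  (U <= rc (Vann c i))%MS = (U *m (rc (lcs c i))^T == 0).
Proof. by rewrite map_kermx map_trmx; apply/sub_kermxP/eqP. Qed.

Lemma Vann_subS i : (Vann c i <= Vann c i.+1)%MS.
Proof.
have /submxP[D Di] := lcsS_sub i; rewrite Vann_subE Di trmx_mul mulmxA.
by have /eqP-> : Vann c i *m (lcs c i)^T == 0; rewrite ?mul0mx // -Vann_subE.
Qed.

(** The entries of [lcs c i *m dmx c a] are the values of [a] on the brackets that span the next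
    term of the series. *)
Lemma Vann_succ (a : 'rV[R]_N) i :
  (a <= Vann c i.+1)%MS = (lcs c i *m dmx c a == 0).
Proof.
have E r k : (br c (row r (lcs c i)) (ebase R k) <= kermx a^T)%MS
             = ((lcs c i *m dmx c a) r k == 0).
  have -> : (lcs c i *m dmx c a) r k = ev a (br c (row r (lcs c i)) (ebase R k)).
    by rewrite br_dmx /ebase trmx_delta -colE -row_mul !mxE.
  rewrite evE; apply/sub_kermxP/eqP => [/(congr1 trmx)|/eqP H].
    by rewrite trmx_mul trmxK trmx0 => ->; rewrite mxE.
  apply: trmx_inj; rewrite trmx_mul trmxK trmx0.
  by apply/matrixP => i0 j0; rewrite !ord1 (eqP H) mxE.
rewrite Vann_subE -(inj_eq trmx_inj) trmx_mul trmxK trmx0.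
transitivity (lcs c i.+1 <= kermx a^T)%MS; first by apply/eqP/sub_kermxP.
apply/lcs_subP/eqP => [H | H r k]; last by rewrite E H mxE.
by apply/matrixP => r k; rewrite [RHS]mxE; apply/eqP; rewrite -E.
Qed.

Lemma dmx_rc (a : 'rV[R]_N) : dmx (cC c) (rc a) = rc (dmx c a).
Proof.
apply/matrixP => i j; rewrite !mxE /ev rmorph_sum.
by apply: eq_bigr => l _; rewrite !mxE rmorphM.
Qed.

Lemma rc_Vann_succ (xi : 'rV[C]_N) i :
  (xi <= rc (Vann c i.+1))%MS = (rc (lcs c i) *m dmx (cC c) xi == 0).
Proof.
rewrite (rc_ReIm xi) rc_ReIm_sub !Vann_succ -rc_ReIm_eq0.
by rewrite [in RHS]addrC dmxP !dmx_rc mulmxDr -scalemxAr -!map_mxM addrC.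
Qed.

Lemma sub_bidual (F : fieldType) m n p (A : 'M[F]_(m, p)) (X : 'M[F]_(p, n)) :
  kermx A^T *m X = 0 -> (X^T <= A)%MS.
Proof.
move=> AX; rewrite submxE -(inj_eq trmx_inj) trmx_mul trmxK trmx0.
have /submxP[D ->] : ((cokermx A)^T <= kermx A^T)%MS.
  by apply/sub_kermxP; rewrite -trmx_mul mulmx_coker trmx0.
by rewrite -mulmxA AX mulmx0.
Qed.

(** By biduality, a vector killed by both annihilators lies in [A] and in [B], hence in the
    intersection, where [U] vanishes. *)
Lemma sub_add_ann (F : fieldType) m n k p
    (A : 'M[F]_(m, p)) (B : 'M[F]_(n, p)) (U : 'M[F]_(k, p)) :
  U *m (A :&: B)%MS^T = 0 -> (U <= kermx A^T + kermx B^T)%MS.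
Proof.
move=> UAB; rewrite submxE.
set S := (_ + _)%MS; set X := cokermx S.
have SX0 n' (D : 'M_(n', p)) : (D <= S)%MS -> D *m X = 0.
  by case/submxP=> u ->; rewrite -mulmxA mulmx_coker mulmx0.
have /submxP[D /(congr1 trmx)] : (X^T <= A :&: B)%MS.
  by rewrite sub_capmx !sub_bidual ?SX0 ?addsmxSl ?addsmxSr.
by rewrite trmxK trmx_mul => ->; rewrite mulmxA UAB mul0mx.
Qed.

Lemma dmx_cC_skew (xi : 'rV[C]_N) :
  (forall i j, c i j = - c j i) -> (dmx (cC c) xi)^T = - dmx (cC c) xi.
Proof. by move=> skew; apply: dmx_skew => i j; rewrite /cC skew map_mxN. Qed.

Lemma Vann_line i :
  dimVquot c i = 1%N -> exists a, (Vann c i.+1 <= Vann c i + (a : 'rV[R]_N))%MS.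
Proof.
rewrite /dimVquot; set W := (_ :\: _)%MS => rkW; exists (nz_row W).
have rk1 : \rank (nz_row W) = 1%N.
  by rewrite rank_rV nz_row_eq0 -mxrank_eq0 rkW.
have [_ /esym] := mxrank_leqif_sup (nz_row_sub W); rewrite rk1 rkW eqxx => Wa.
by rewrite -(addsmx_diff_cap_eq _ (Vann c i)) addsmxC addsmxS // capmxSr.
Qed.

Lemma rank_Vann_succ i :
  dimVquot c i = 1%N -> \rank (Vann c i.+1) = (\rank (Vann c i)).+1.
Proof.
rewrite /dimVquot => rk1.
by rewrite -(mxrank_cap_compl _ (Vann c i)) rk1 (capmx_idPr (Vann_subS i)) addn1.
Qed.

Lemma rank_cap_Vann_succ n (A : 'M[C]_(n, N)) i : dimVquot c i = 1%N ->
  (\rank (A :&: rc (Vann c i.+1))%MS <= (\rank (A :&: rc (Vann c i))%MS).+1)%N.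
Proof.
move=> /rank_Vann_succ rkV.
have sV : (rc (Vann c i) <= rc (Vann c i.+1))%MS by rewrite map_submx Vann_subS.
have := mxrank_sum_cap (A :&: rc (Vann c i.+1))%MS (rc (Vann c i)).
rewrite -capmxA (cap_eqmx (eqmx_refl A) (capmx_idPr sV)).
have : (\rank (A :&: rc (Vann c i.+1) + rc (Vann c i))%MS <= \rank (rc (Vann c i.+1)))%N.
  by apply: mxrankS; rewrite addsmx_sub capmxSr.
by move: rkV; rewrite !mxrank_map; lia.
Qed.

(** * Growth of the intersections of [K] with the [V i] *)

Section Subalgebra.
Variables (q : nat) (E : 'M[C]_(q, N)).
Local Notation K := (kermx E^T).
Hypothesis skew : forall i j, c i j = - c j i.
Hypothesis E_closed : forall th, (th <= K)%MS -> E *m dmx (cC c) th *m E^T = 0.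
Hypothesis K_conj0 : forall n (A : 'M[C]_(n, N)),
  (A <= K)%MS -> (map_mx (@conjc R) A <= K)%MS -> A = 0.

Let dmxT th : (dmx (cC c) th)^T = - dmx (cC c) th.
Proof. exact: dmx_cC_skew. Qed.

Let G i := rc (lcs c i).
Let V i := rc (Vann c i).

Lemma conj_rc n (A : 'M[R]_(n, N)) : map_mx (@conjc R) (rc A) = rc A.
Proof. by apply/matrixP => i j; rewrite !mxE conjc_real. Qed.

Lemma K_real0 n (A : 'M[R]_(n, N)) : (rc A <= K)%MS -> A = 0.
Proof.
move=> AK; apply/eqP; rewrite -(map_mx_eq0 (real_complex R)); apply/eqP.
by apply: K_conj0; rewrite // conj_rc.
Qed.

(** For [th] in [K :&: V i.+1], d th vanishes on E x E and on g^i x g, which forces d th = 0; then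
    [th] lies in [V 1], inside [V i] because [0 < i]. *)
Lemma cap_Vann_eq0 i :
  (0 < i)%N -> (K :&: V i)%MS = 0 -> (K :&: V i.+1)%MS = 0.
Proof.
move=> i_gt0 KVi; apply/eqP; rewrite -submx0; apply/rV_subP => th.
rewrite sub_capmx => /andP[thK thV].
have Gth : G i *m dmx (cC c) th = 0 by apply/eqP; rewrite -rc_Vann_succ.
have thG : dmx (cC c) th *m (G i)^T = 0.
  by apply: trmx_inj; rewrite trmx_mul trmxK trmx0 dmxT mulmxN Gth oppr0.
have cap0 n (U : 'M_(n, N)) : U *m E^T = 0 -> U *m (G i)^T = 0 -> U = 0.
  move=> UE UG; apply/eqP; rewrite -submx0 -KVi sub_capmx rc_Vann_subE.
  by rewrite UG eqxx andbT; apply/sub_kermxP.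
(* First E *m dmx th, then dmx th itself, has its rows in K :&: V i. *)
have Eth : E *m dmx (cC c) th = 0.
  by apply: cap0; [exact: E_closed | rewrite -mulmxA thG mulmx0].
have th0 : dmx (cC c) th = 0.
  apply: cap0 => //; apply: trmx_inj.
  by rewrite trmx_mul trmxK trmx0 dmxT mulmxN Eth oppr0.
have thV1 : (th <= V 1)%MS by rewrite rc_Vann_succ th0 mulmx0.
have V1i : (V 1 <= V i)%MS.
  rewrite map_submx; case: i i_gt0 {KVi thV Gth thG cap0} => // i _.
  by elim: i => // i IH; apply: submx_trans IH (Vann_subS _).
by rewrite -KVi sub_capmx thK (submx_trans thV1 V1i).
Qed.

(** Surjectivity of E cap g^i onto g^i/g^(i+1) is used in dual form: the covectors [a] [x, .] with x
    in E are shown to lie in [V i]. *)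
Lemma cap_Vann_stable i : dimVquot c i.+1 = 1%N ->
  (K :&: V i.+1 <= V i)%MS -> (K :&: V i.+2 <= V i.+1)%MS.
Proof.
move=> /Vann_line[a Va] KVi; apply/rV_subP => th.
rewrite sub_capmx => /andP[thK thV].
have : (th <= V i.+1 + rc a)%MS.
  by rewrite (submx_trans thV) // -map_addsmx map_submx.
case/sub_addsmxP=> -[u1 u2] /= thE.
set v := u1 *m V i.+1 in thE; pose z := u2 0 0.
have {}thE : th = z *: rc a + v.
  by rewrite addrC thE [u2]mx11_scalar mul_scalar_mx.
have vV : (v <= V i.+1)%MS by exact: submxMl.
have [z0|z0] := eqVneq z 0; first by rewrite thE z0 scale0r add0r.
have aV : (rc a <= V i.+2)%MS.
  have -> : rc a = z^-1 *: (th - v) by rewrite thE addrK scalerA mulVf // scale1r.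
  apply: scalemx_sub; apply: addmx_sub thV _; rewrite eqmx_opp.
  by apply: submx_trans vV _; rewrite map_submx Vann_subS.
pose A := dmx (cC c) (rc a).
have AT : A^T = - A := dmxT _.
have GA : G i.+1 *m A = 0 by apply/eqP; rewrite -rc_Vann_succ.
have Gv : G i *m dmx (cC c) v = 0 by apply/eqP; rewrite -rc_Vann_succ.
have flip n p (X : 'M_(n, N)) (Y : 'M_(p, N)) : X *m A *m Y^T = 0 -> Y *m A *m X^T = 0.
  move=> XY; apply: trmx_inj.
  by rewrite !trmx_mul trmxK AT mulNmx mulmxN mulmxA XY oppr0 trmx0.
have UV : (E *m A <= V i.+1)%MS.
  by rewrite rc_Vann_subE; apply/eqP/flip; rewrite GA mul0mx.
(* On E cap g^i the form of [v] vanishes, so [z *: A] agrees there with the form of [th], which is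
   zero against E. *)
have UKV : (E *m A <= K + V i)%MS.
  pose H := (E :&: G i)%MS.
  have HAE : H *m A *m E^T = 0.
    have : H *m dmx (cC c) th *m E^T = 0.
      have /submxP[D ->] : (H <= E)%MS by exact: capmxSl.
      by rewrite -!mulmxA (mulmxA E) E_closed // mulmx0.
    rewrite thE dmxP mulmxDr -scalemxAr.
    have /submxP[D ->] : (H <= G i)%MS by exact: capmxSr.
    rewrite -[_ *m G i *m dmx _ v]mulmxA Gv mulmx0 addr0 -scalemxAl => /eqP.
    by rewrite scaler_eq0 (negPf z0) => /eqP.
  rewrite /V /Vann map_kermx -map_trmx; apply: sub_add_ann; exact: flip.
(* Modular law: since [V i] lies in [V i.+1], the component in [K] falls into [K :&: V i.+1], hence
   into [V i]. *)
have {UV UKV} : (E *m A <= V i)%MS.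
  have : (E *m A <= (V i + K) :&: V i.+1)%MS by rewrite sub_capmx UV addsmxC UKV.
  rewrite -matrix_modl ?map_submx ?Vann_subS // => /submx_trans; apply.
  by rewrite addsmx_sub submx_refl.
rewrite rc_Vann_subE => /eqP/flip GAE.
(* These rows are real covectors annihilating E, and [K] contains no nonzero real covector. *)
have : rc (lcs c i *m dmx c a) = 0 :> 'M[C]_N.
  have -> : lcs c i *m dmx c a = 0; last by rewrite map_mx0.
  by apply: K_real0; rewrite map_mxM -dmx_rc; apply/sub_kermxP.
move/eqP; rewrite map_mxM -dmx_rc -rc_Vann_succ => aV1.
by rewrite thE addmx_sub // scalemx_sub.
Qed.

Let kap i := \rank (K :&: V i)%MS.

(** [X] and its conjugate have equal dimension, meet in zero, and both lie in the complexification
    of [W]. *)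
Lemma rank_cap_rc_double n (W : 'M[R]_(n, N)) : (2 * \rank (K :&: rc W)%MS <= \rank W)%N.
Proof.
set X := (K :&: rc W)%MS; pose Y := map_mx (@conjc R) X.
have XY0 : (X :&: Y)%MS = 0.
  apply: K_conj0; first exact: submx_trans (capmxSl _ _) (capmxSl _ _).
  have : (map_mx (@conjc R) (X :&: Y)%MS <= map_mx (@conjc R) Y)%MS.
    by rewrite map_submx capmxSr.
  have -> : map_mx (@conjc R) Y = X.
    by apply/matrixP => s t; rewrite !mxE conjcK.
  by move/submx_trans; apply; apply: capmxSl.
have YV : (Y <= rc W)%MS by rewrite -[rc W]conj_rc map_submx capmxSr.
have : (\rank (X + Y)%MS <= \rank (rc W))%N.
  by apply: mxrankS; rewrite addsmx_sub YV capmxSr.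
by rewrite (mxrank_disjoint_sum XY0) !mxrank_map; lia.
Qed.

Lemma cap_Vann_subS i : (K :&: V i <= K :&: V i.+1)%MS.
Proof. by rewrite capmxS // map_submx Vann_subS. Qed.

Lemma rank_cap_Vann_stable i : dimVquot c i.+1 = 1%N ->
  (kap i.+1 <= kap i)%N -> (kap i.+2 <= kap i.+1)%N.
Proof.
move=> dV kapi; apply: mxrankS; rewrite sub_capmx capmxSl /=.
apply: cap_Vann_stable => //; apply: submx_trans (capmxSr K _).
by rewrite -(mxrank_leqif_sup (cap_Vann_subS i)) eqn_leq kapi mxrankS ?cap_Vann_subS.
Qed.

Lemma rank_K_bound j m : (0 < j <= m)%N -> (1 < \rank K)%N -> lcs c m = 0 ->
  (forall i, (j <= i < m)%N -> dimVquot c i = 1%N) ->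
  (\rank K + m + 1 + (1 < j) <= N + j)%N.
Proof.
move=> /andP[j_gt0 jm] K_gt1 lcsm dV.
have Vm : \rank (Vann c m) = N.
  by rewrite mxrank_ker lcsm trmx0 mxrank0 subn0.
have kapm : kap m = \rank K.
  have /capmx_idPl KV : (K <= V m)%MS.
    by rewrite rc_Vann_subE lcsm map_mx0 trmx0 mulmx0.
  by rewrite /kap KV.
have kap0 : kap 0 = 0%N.
  apply/eqP; rewrite mxrank_eq0 -submx0; apply: submx_trans (capmxSr _ _) _.
  have := submx_refl (V 0); rewrite rc_Vann_subE /= map_mx1 trmx1 mulmx1.
  by move=> /eqP->.
have kapS i : (kap i <= kap i.+1)%N by rewrite mxrankS ?cap_Vann_subS.
have kap_eq0 i : (0 < i)%N -> kap i = 0%N -> kap i.+1 = 0%N.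
  move=> i_gt0 /eqP; rewrite mxrank_eq0 => /eqP /(cap_Vann_eq0 i_gt0) Ki.
  by rewrite /kap Ki mxrank0.
(* From here [j] is the predecessor of the given index, so that [kap j] and [kap j.+1] can be
   compared. *)
case: j j_gt0 jm dV => // j _ jm dV.
(* The last clause says: either every step from [j.+1] on brought growth, and for t > 0 so did the
   step from [j] to [j.+1]; or the latest step brought none. *)
have H t : (j.+1 + t <= m)%N ->
  [/\ (1 < kap (j.+1 + t) -> kap (j.+1 + t) + 1 + (1 < j.+1) <= \rank (Vann c j.+1))%N,
      \rank (Vann c (j.+1 + t)) = (\rank (Vann c j.+1) + t)%N
    & kap (j.+1 + t) = (kap j.+1 + t)%N /\ (t = 0%N \/ (kap j < kap j.+1)%N)
      \/ (kap (j.+1 + t) <= kap (j + t))%N].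
  elim: t => [_|t IH jt].
    rewrite !addn0; split; [|by []|by left; split=> //; left].
    by have := rank_cap_rc_double (Vann c j.+1); rewrite -/(kap _); lia.
  have [bnd rkV alt] := IH ltac:(lia).
  have dVt : dimVquot c (j + t).+1 = 1%N by apply: dV; lia.
  have kap_le := rank_cap_Vann_succ K dVt.
  have stab := rank_cap_Vann_stable dVt.
  have dbl := rank_cap_rc_double (Vann c (j + t).+2).
  have rkVt := rank_Vann_succ dVt.
  (* Hence [kap j.+1] is at least 2 when [0 < j]: the source of the extra unit [1 < j.+1] in the
     bound. *)
  have kapj : (0 < j)%N -> (kap j < kap j.+1)%N -> (0 < kap j)%N.
    by move=> j_gt0 lt_kap; case: (posnP (kap j)) => // /(kap_eq0 _ j_gt0); lia.
  have kapj0 : j = 0%N -> kap j = 0%N by move=> ->.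
  rewrite -!/(kap _) in kap_le dbl.
  rewrite !addSn !addnS in bnd rkV alt *.
  have kapt : t = 0%N -> kap (j + t) = kap j by move=> ->; rewrite addn0.
  (* Without growth the old bound persists. With growth, [stab] forces growth at all earlier steps,
     and [dbl] bounds [kap (j + t).+2] by dim V_(j+1) - [kap j.+1]. *)
  have [le|gt] := leqP (kap (j + t).+2) (kap (j + t).+1).
    by split; [have := kapS (j + t).+1; lia | lia | right].
  by split; [lia | lia | left; lia].
have [] := H (m - j.+1)%N ltac:(lia).
by rewrite subnKC // kapm Vm; lia.
Qed.

End Subalgebra.

(** * The eigenspace L and its projection E *)

Section GenComplex.
Variable J : 'M[R]_(N + N).
Hypothesis gcJ : is_gen_complex c J.
Let E := lsubmx (Lspace J).
Local Notation K := (kermx E^T).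
Local Notation Jc := (JC J).

Lemma Lspace_subE n (A : 'M[C]_(n, N + N)) : (A <= Lspace J)%MS = (A *m Jc == I *: A).
Proof. exact: (sameP eigenspaceP eqP). Qed.

(** Gram matrix of twice the inner product. *)
Let Q (F : fieldType) : 'M[F]_(N + N) := block_mx 0 1%:M 1%:M 0.

Lemma pairingE (A B : 'rV[R]_(N + N)) : pairing A B = 2^-1 * (A *m Q R *m B^T) 0 0.
Proof.
rewrite /pairing; congr (_ * _); rewrite !evE -[in RHS](hsubmxK A) -[in RHS](hsubmxK B).
rewrite tr_row_mx mul_row_block !mulmx0 !mulmx1 add0r addr0 mul_row_col [RHS]mxE.
congr (_ + _); rewrite -[in RHS](trmxK (lsubmx A)) -trmx_mul [RHS]mxE //.
Qed.

Lemma JC_sqr : Jc *m Jc = - 1%:M.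
Proof. by case: gcJ => JJ _ _; rewrite -map_mxM JJ map_mxN map_mx1. Qed.

(** An orthogonal map with square -1 is skew-adjoint. *)
Lemma JC_skew : Q C *m Jc^T = - Jc *m Q C.
Proof.
have QJ : J *m Q R *m J^T = Q R.
  case: gcJ => _ orth _; apply/matrixP => i j.
  have := orth (delta_mx 0 i) (delta_mx 0 j).
  rewrite !pairingE => /mulfI; rewrite invr_eq0 pnatr_eq0 => /(_ isT).
  have dE (M : 'M[R]_(N + N)) : ((delta_mx 0 i : 'rV_(N + N)) *m M *m (delta_mx j 0 : 'cV_(N + N))) 0 0 = M i j.
    by rewrite -colE -rowE !mxE.
  rewrite trmx_mul !trmx_delta !mulmxA -[_ *m J *m _]mulmxA -[_ *m (J *m _) *m _]mulmxA.
  by rewrite !dE.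
have rcQ : rc (Q R) = Q C by rewrite map_block_mx !map_mx0 !map_mx1.
have {}QJ : Jc *m Q C *m Jc^T = Q C.
  by rewrite -[in RHS]rcQ -QJ !map_mxM rcQ map_trmx.
by rewrite -[in RHS]QJ !mulmxA !mulNmx JC_sqr !mulNmx mul1mx opprK.
Qed.

(** A covector killing E is orthogonal to L; by skew-adjointness of J this orthogonality becomes the
    eigenvalue equation. *)
Lemma K_sub_Lspace n (A : 'M[C]_(n, N)) : (A <= K)%MS -> (row_mx 0 A <= Lspace J)%MS.
Proof.
move=> /sub_kermxP AE; rewrite Lspace_subE.
set B := row_mx 0 A; pose P := 1%:M - I *: Jc.
have PL : (P <= Lspace J)%MS.
  rewrite Lspace_subE mulmxBl mul1mx -scalemxAl JC_sqr scalerBr scalerA mulii.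
  by rewrite scalerN scaleN1r !opprK addrC.
(* B annihilates P for the pairing Q, and P spans the projection to L. *)
have BQP : B *m Q C *m P^T = 0.
  rewrite mul_row_block !mul0mx !mulmx1 mulmx0 add0r addr0 -[P]hsubmxK tr_row_mx.
  rewrite mul_row_col mul0mx addr0.
  have /submxP[D ->] : (lsubmx P <= E)%MS.
    by have /submxP[D ->] := PL; rewrite -mulmx_lsub submxMl.
  by rewrite trmx_mul mulmxA AE mul0mx.
have {}BQP : (B + I *: (B *m Jc)) *m Q C = 0.
  rewrite -BQP linearB /= trmx1 mulmxBr mulmx1 linearZ /= -scalemxAr -mulmxA JC_skew.
  by rewrite mulNmx mulmxN scalerN opprK mulmxDl -scalemxAl mulmxA.
have QQ : Q C *m Q C = 1%:M.
  by rewrite mulmx_block !mulmx0 !mul0mx !mulmx1 !add0r !addr0 -scalar_mx_block.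
have : B + I *: (B *m Jc) = 0 by rewrite -[LHS]mulmx1 -QQ mulmxA BQP mul0mx.
move/(congr1 ( *:%R I)); rewrite scaler0 scalerDr scalerA mulii scaleN1r => /eqP.
by rewrite subr_eq0 eq_sym.
Qed.

(** J is real, so conjugating the second eigenvalue equation makes the same covectors eigenvectors
    for both i and -i. *)
Lemma K_conj0 n (A : 'M[C]_(n, N)) :
  (A <= K)%MS -> (map_mx (@conjc R) A <= K)%MS -> A = 0.
Proof.
have conj_J : map_mx (@conjc R) Jc = Jc.
  by apply/matrixP => i j; rewrite !mxE conjc_real.
move=> /K_sub_Lspace; rewrite Lspace_subE => /eqP AJ.
move=> /K_sub_Lspace; rewrite Lspace_subE => /eqP /(congr1 (map_mx (@conjc R))).
rewrite map_mxM conj_J map_mxZ map_row_mx map_mx0.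
have -> : map_mx (@conjc R) (map_mx (@conjc R) A) = A.
  by apply/matrixP => i j; rewrite !mxE conjcK.
rewrite AJ => /eqP; rewrite -subr_eq0 -scalerBl scaler_eq0.
rewrite eq_complex /= subrr eqxx /= opprK -mulr2n mulrn_eq0 oner_eq0 /=.
by move/eqP/(congr1 rsubmx); rewrite row_mxKr linear0.
Qed.

(** The vector part of the Courant bracket is the Lie bracket, so E is a subalgebra. *)
Lemma E_closed th : (th <= K)%MS -> E *m dmx (cC c) th *m E^T = 0.
Proof.
move=> /sub_kermxP thE; apply/matrixP => r s.
have -> : (E *m dmx (cC c) th *m E^T) r s = ev th (br (cC c) (row r E) (row s E)).
  by rewrite br_dmx -row_mul !mxE; apply: eq_bigr => i _; rewrite !mxE.
have : (br (cC c) (row r E) (row s E) <= E)%MS.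
  case: gcJ => _ _ /(_ _ _ (row_sub r (Lspace J)) (row_sub s (Lspace J))).
  case/submxP => D /(congr1 lsubmx).
  rewrite row_mxKl -mulmx_lsub.
  have Er i : lsubmx (row i (Lspace J)) = row i E by apply/rowP => l; rewrite !mxE.
  by rewrite !Er => ->; rewrite submxMl.
by case/submxP => D ->; rewrite evE trmx_mul mulmxA thE mul0mx !mxE.
Qed.

Lemma rank_ann_proj : \rank K = gc_type J.
Proof. by rewrite mxrank_ker mxrank_tr. Qed.

Lemma gc_type_double : (2 * gc_type J <= N)%N.
Proof.
have := rank_cap_rc_double K_conj0 1%:M.
by rewrite map_mx1 capmx1 rank_ann_proj mxrank1.
Qed.

End GenComplex.
End Main.

Theorem theorem2 (R : realType) (n : nat)
  (c : 'I_(2 * n) -> 'I_(2 * n) -> 'rV[R]_(2 * n))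
  (m : nat) (J : 'M[R]_(2 * n + 2 * n)) (k j : nat) :
  is_lie_algebra c ->
  is_nilindex c m ->
  is_gen_complex c J ->
  gc_type J = k ->
  (1 < k)%N ->
  (0 < j)%N ->
  (forall i : nat, (j <= i)%N -> (i <= m - 1)%N -> dimVquot c i = 1%N) ->
  (if (1 < j)%N
   then (k%:Z <= (2 * n)%:Z - m%:Z + j%:Z - 2)%R
   else (k%:Z <= (2 * n)%:Z - m%:Z)%R).
Proof.
move=> [alt _] [lcsm _] gcJ <- k_gt1 j_gt0 dV.
have skew := structure_skew alt.
(* For [m < j] no quotient is constrained, and 2k <= 2n with k > 1 already gives the bound. *)
have [jm|mj] := leqP j m; last first.
  have := gc_type_double gcJ; case: ifP; lia.
have := @rank_K_bound _ _ c _ _ skew (E_closed gcJ) (K_conj0 gcJ) j m.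
rewrite rank_ann_proj j_gt0 jm => /(_ isT k_gt1 lcsm).
have dV' i : (j <= i < m)%N -> dimVquot c i = 1%N by move=> ?; apply: dV; lia.
move=> /(_ dV'); case: ifP; lia.
Qed.
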